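(* Let $G$ be a graph on $\nu$ vertices and let $n$ be a positive integer with $\nu\equiv n\pmod 2$ and $\delta(G)\geq (\nu+n)/2-1$. Suppose that $G$ cannot be expressed as $G=G_0\vee(G_1\cup G_2)$ where $(\nu-n)/2$ is odd, $G_0$ has $n$ vertices and $G_1=G_2=K_{(\nu-n)/2}$. Then $G$ is $n$-factor-critical if and only if $\alpha(G)\leq (\nu-n)/2$.
   Context: All graphs are undirected, simple, finite and connected. $\delta(G)$ is the minimum degree and $\alpha(G)$ the independence number of $G$. A graph $G$ is $n$-factor-critical if $G-S$ has a perfect matching for every $S\subseteq V(G)$ with $|S|=n$. For disjoint graphs $G_1,G_2$, the union $G_1\cup G_2$ has vertex set $V(G_1)\cup V(G_2)$ and edge set $E(G_1)\cup E(G_2)$; the join $G_1\vee G_2$ is obtained from $G_1\cup G_2$ by joining every vertex of $G_1$ to every vertex of $G_2$. $K_m$ is the complete graph on $m$ vertices.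
   Formalization: The hypothesis n < ν is added: for n = ν the degree condition forces G = K_n, which is trivially n-factor-critical (deleting all vertices leaves the empty graph, matched by the empty matching) although α(G) = 1 > 0 = (ν−n)/2. *)

(* Defs.v *)
From mathcomp Require Import all_boot.

Set Implicit Arguments.
Unset Strict Implicit.
Unset Printing Implicit Defensive.

Record sgraph := SGraph {
  vertex :> finType;
  adj : rel vertex;
  adj_sym : symmetric adj;
  adj_irrefl : irreflexive adj }.

Definition connected (G : sgraph) : Prop :=
  forall x y : G, connect (@adj G) x y.

Definition degree (G : sgraph) (x : G) : nat := #|[set y | adj x y]|.

(* The default value #|G| exceeds every degree, so it does not affect the
   minimum unless G has no vertex. *)
Definition min_degree (G : sgraph) : nat :=
  \big[minn/#|G|]_(x : G) degree x.

Definition independent (G : sgraph) (A : {set G}) : bool :=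
  [forall x in A, forall y in A, ~~ adj x y].

Definition independence_number (G : sgraph) : nat :=
  \max_(A : {set G} | independent A) #|A|.

Definition edges (G : sgraph) : {set {set G}} :=
  [set [set p.1; p.2] | p in [set p : G * G | adj p.1 p.2]].

Definition perfect_matching (G : sgraph) (M : {set {set G}}) : bool :=
  [&& M \subset edges G, trivIset M & cover M == [set: G]].

Section Delete.
Variables (G : sgraph) (S : {set G}).
Definition delete_adj : rel {x : G | x \notin S} :=
  fun x y => adj (val x) (val y).
Lemma delete_adj_sym : symmetric delete_adj.
Proof. by move=> x y; apply: adj_sym. Qed.
Lemma delete_adj_irrefl : irreflexive delete_adj.
Proof. by move=> x; apply: adj_irrefl. Qed.
Definition delete : sgraph := SGraph delete_adj_sym delete_adj_irrefl.
End Delete.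

Section UnionJoin.
Variables G1 G2 : sgraph.

Definition union_adj : rel (G1 + G2) := fun x y =>
  match x, y with
  | inl a, inl b => adj a b
  | inr a, inr b => adj a b
  | _, _ => false
  end.
Lemma union_adj_sym : symmetric union_adj.
Proof. by move=> [x|x] [y|y] //=; apply: adj_sym. Qed.
Lemma union_adj_irrefl : irreflexive union_adj.
Proof. by move=> [x|x] /=; apply: adj_irrefl. Qed.
Definition graph_union : sgraph := SGraph union_adj_sym union_adj_irrefl.

Definition join_adj : rel (G1 + G2) := fun x y =>
  match x, y with
  | inl a, inl b => adj a b
  | inr a, inr b => adj a b
  | _, _ => true
  end.
Lemma join_adj_sym : symmetric join_adj.
Proof. by move=> [x|x] [y|y] //=; apply: adj_sym. Qed.
Lemma join_adj_irrefl : irreflexive join_adj.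
Proof. by move=> [x|x] /=; apply: adj_irrefl. Qed.
Definition graph_join : sgraph := SGraph join_adj_sym join_adj_irrefl.
End UnionJoin.

Section Complete.
Variable m : nat.
Definition complete_adj : rel 'I_m := fun x y => x != y.
Lemma complete_adj_sym : symmetric complete_adj.
Proof. by move=> x y; rewrite /complete_adj eq_sym. Qed.
Lemma complete_adj_irrefl : irreflexive complete_adj.
Proof. by move=> x; rewrite /complete_adj eqxx. Qed.
Definition complete_graph : sgraph :=
  SGraph complete_adj_sym complete_adj_irrefl.
End Complete.

Definition isomorphic (G H : sgraph) : Prop :=
  exists2 f : G -> H, bijective f & forall x y : G, adj (f x) (f y) = adj x y.

(* For n = #|G| the only S is the whole vertex set, and the vertexless graph
   has the empty perfect matching, so the condition holds trivially; for
   n > #|G| it is vacuous. The notion is meaningful only for n < #|G|. *)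
Definition factor_critical (n : nat) (G : sgraph) : Prop :=
  forall S : {set G}, #|S| = n ->
    exists M : {set {set delete S}}, perfect_matching M.

(* Main.v *)
Require Import Defs.
From mathcomp Require Import all_boot.
From mathcomp Require Import zify.

Set Implicit Arguments.
Unset Strict Implicit.
Unset Printing Implicit Defensive.

(** Put m = (nu - n)/2. An independent set with more than m vertices survives
    the deletion of n other vertices and is then too large for a perfect
    matching of the 2m remaining ones. Conversely, let H = G - S with |S| = n, so
    that H has 2m vertices and minimum degree at least m - 1, and suppose that
    a maximum matching of H misses u and v. Having no augmenting path, together
    with the degree bound, forces exactly two of the four possible edges
    between {u, v} and each matching edge. Replacing a matching edge xy by ux,
    where x is adjacent to u, gives a maximum matching missing y and v, to
    which the same applies. If no matching edge forms a triangle with u then u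
    and v have the same neighbours, whose complement is an independent set of
    m + 1 vertices. Otherwise u and v have no common neighbour, and H is the
    disjoint union of two complete graphs on m vertices, with m odd; by the
    degree bound in G every vertex of H is adjacent to all of S, which is the
    excluded case. *)

(** * Parity of involutions and a bound on minima *)

Lemma card_involution_even (T : finType) (f : T -> T) (A : {set T}) :
  involutive f -> {in A, forall x, f x \in A} -> {in A, forall x, f x != x} ->
  ~~ odd #|A|.
Proof.
move=> fK; have [k] := ubnP #|A|; elim: k A => // k IHk A ltAk fA nfix.
have [-> | [x xA]] := set_0Vmem A; first by rewrite cards0.
(* The induction removes the two-element orbit of [x]. *)
have fxA : f x \in A :\ x by rewrite !inE nfix // fA.
have cardA : #|A| = #|A :\ x :\ f x|.+2.
  by rewrite (cardsD1 x) xA (cardsD1 (f x)) fxA.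
rewrite cardA /= negbK; apply: IHk; first by move: ltAk; rewrite cardA; lia.
- move=> y; rewrite !inE => /and3P[yfx yx yA].
  by rewrite (inj_eq (inv_inj fK)) yx (inv_eq fK) yfx fA.
by move=> y; rewrite !inE => /and3P[_ _ yA]; apply: nfix.
Qed.

Lemma bigmin_leq (T : finType) (d : nat) (F : T -> nat) (x : T) :
  \big[minn/d]_(y : T) F y <= F x.
Proof.
have: x \in index_enum T by rewrite mem_index_enum.
elim: (index_enum T) => // y s IHs; rewrite inE big_cons geq_min.
by case/predU1P => [-> | /IHs ->]; rewrite ?leqnn ?orbT.
Qed.

(** * Matchings as involutions, and the exchange of edges *)

Section InvolutiveMatchings.
Variable H : sgraph.
Implicit Types (f g : {ffun H -> H}) (u v x y z : H).

Notation nbhd x := [set y | adj x y].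

(* A matching is encoded by the involution exchanging the ends of its edges;
   the unmatched vertices are the fixed points. *)
Definition matching f : bool :=
  [forall x, (f (f x) == x) && ((f x == x) || adj x (f x))].

Definition unmatched f : {set H} := [set x | f x == x].

Definition maximum_matching f : Prop :=
  matching f /\ forall g, matching g -> #|unmatched f| <= #|unmatched g|.

Lemma matchingK f : matching f -> involutive f.
Proof. by move=> /forallP mf x; case/andP: (mf x) => /eqP. Qed.

Lemma matching_adj f x : matching f -> f x != x -> adj x (f x).
Proof. by move=> /forallP mf; case/andP: (mf x) => _ /orP[->|]. Qed.

Lemma ex_maximum_matching : exists f, maximum_matching f.
Proof.
pose id_match := [ffun x : H => x].
have m_id : matching id_match by apply/forallP => x; rewrite !ffunE eqxx.
case: (arg_minnP (fun f => #|unmatched f|) m_id) => f mf minf.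
by exists f.
Qed.

(** For an unmatched [u] adjacent to [x], the edge [u x] replaces [x (f x)], so that [f x] becomes
    unmatched instead of [u]. *)
Definition rematch f u x : {ffun H -> H} :=
  [ffun t => if t == u then x else if t == x then u
             else if t == f x then t else f t].

Lemma rematch_matching f u x :
  matching f -> f u = u -> adj u x -> matching (rematch f u x).
Proof.
move=> mf fu ux; have fK := matchingK mf.
have xu : x != u by apply: contraTneq ux => ->; rewrite adj_irrefl.
apply/forallP => t; rewrite !ffunE.
have [-> | tu] := eqVneq t u; first by rewrite (negPf xu) !eqxx ux orbT.
have [-> | tx] := eqVneq t x; first by rewrite !eqxx adj_sym ux orbT.
have [tfx | tfx] := eqVneq t (f x); first by rewrite (negPf tu) (negPf tx) tfx !eqxx.
have -> : (f t == u) = false by rewrite (inv_eq fK) fu (negPf tu).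
have -> : (f t == x) = false by rewrite (inv_eq fK) (negPf tfx).
rewrite (inj_eq (inv_inj fK)) (negPf tx) fK eqxx /=.
by have [//| ftt] := eqVneq (f t) t; rewrite matching_adj.
Qed.

Lemma unmatched_rematch f u x :
  matching f -> f u = u -> adj u x ->
  unmatched (rematch f u x) = (f x |: unmatched f) :\ u :\ x.
Proof.
move=> mf fu ux; have xu : x != u by apply: contraTneq ux => ->; rewrite adj_irrefl.
apply/setP => t; rewrite !inE ffunE.
have [-> | tu] := eqVneq t u; first by rewrite (negPf xu) andbF.
have [-> | tx] := eqVneq t x; first by rewrite eq_sym (negPf xu).
by have [-> | _] := eqVneq t (f x); rewrite ?eqxx.
Qed.

(** An unmatched neighbour [x] could be paired with [u], leaving fewer vertices unmatched. *)
Lemma maximum_matching_nbhd f u x :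
  maximum_matching f -> f u = u -> adj u x -> f x != x.
Proof.
move=> [mf minf] fu ux; apply/eqP => fx.
have := minf _ (rematch_matching mf fu ux); rewrite unmatched_rematch // fx.
apply/negP; rewrite -ltnNge.
have xM : x \in unmatched f by rewrite inE fx.
have uM : u \in unmatched f by rewrite inE fu.
rewrite (setUidPr _) ?sub1set // (cardsD1 u (unmatched f)) uM ltnS.
by apply: subset_leq_card; apply: subD1set.
Qed.

(** The exchange frees [f x] and covers [u], so the number of unmatched vertices does not grow. *)
Lemma maximum_rematch f u x :
  maximum_matching f -> f u = u -> adj u x -> maximum_matching (rematch f u x).
Proof.
move=> maxf fu ux; have [mf minf] := maxf.
have nfx := maximum_matching_nbhd maxf fu ux.
have xu : x != u by apply: contraTneq ux => ->; rewrite adj_irrefl.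
split=> [|g mg]; first exact: rematch_matching.
apply: leq_trans (minf _ mg); rewrite unmatched_rematch //.
have fxM : f x \notin unmatched f by rewrite inE (inj_eq (inv_inj (matchingK mf))).
have uM : u \in f x |: unmatched f by rewrite !inE fu eqxx orbT.
have := cardsU1 (f x) (unmatched f); rewrite fxM (cardsD1 u) uM.
rewrite !add1n => -[<-]; apply: subset_leq_card; exact: subD1set.
Qed.

Lemma rematch_free f u x :
  maximum_matching f -> f u = u -> adj u x -> rematch f u x (f x) = f x.
Proof.
move=> maxf fu ux; have fK := matchingK maxf.1; rewrite ffunE.
rewrite (inv_eq fK) fu.
have -> : (x == u) = false by apply: contraTF ux => /eqP->; rewrite adj_irrefl.
by rewrite (negPf (maximum_matching_nbhd maxf fu ux)) eqxx.
Qed.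

Lemma rematch_id f u x t :
  t != u -> t != x -> t != f x -> rematch f u x t = f t.
Proof. by rewrite ffunE; do 3!move=> /negPf->. Qed.

(** * Two unmatched vertices under the degree bound *)

Variable m : nat.
Hypothesis card_H : #|H| = m.*2.
Hypothesis min_deg : forall x, m - 1 <= degree x.

Lemma unmatched_nadj f u v :
  maximum_matching f -> f u = u -> f v = v -> adj u v = false.
Proof.
move=> maxf fu fv; apply: contraTF isT.
by move=> /(maximum_matching_nbhd maxf fu); rewrite fv eqxx.
Qed.

(* If [u x] and [v (f x)] were both edges then [u x (f x) v] would be an
   augmenting path; so [f] maps the neighbours of [u] off those of [v]; as
   both neighbourhoods avoid [u] and [v], the degree bound leaves no room for
   any further vertex. *)
Lemma unmatched_pair f u v x :
  maximum_matching f -> u != v -> f u = u -> f v = v -> x != u -> x != v ->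
  adj v x = ~~ adj u (f x).
Proof.
move=> maxf uv fu fv xu xv; have fK := matchingK maxf.1.
pose A := f @: nbhd u; pose B := nbhd v; pose C := ~: [set u; v].
have dAB y : (y \in A) && (y \in B) = false.
  apply/negP => /andP[/imsetP[t]].
  rewrite !inE => ut -> vft.
  have vt : v != t by apply: contraTneq ut => <-; rewrite (unmatched_nadj maxf).
  have vft' : v != f t by rewrite -(inv_eq fK) fv.
  have gv : rematch f u t v = v by rewrite rematch_id // eq_sym.
  by have := unmatched_nadj (maximum_rematch maxf fu ut) gv (rematch_free maxf fu ut);
     rewrite vft.
have sABC : A :|: B \subset C.
  apply/subsetP => y; rewrite !inE negb_or => /orP[/imsetP[t]|vy].
    rewrite inE => ut ->; rewrite !(inv_eq fK) fu fv.
    by apply/andP; split; apply: contraTneq ut => ->;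
       rewrite ?adj_irrefl ?(unmatched_nadj maxf).
  by apply/andP; split; apply: contraTneq vy => ->;
     rewrite ?adj_irrefl ?(unmatched_nadj maxf).
have eqABC : A :|: B = C.
  apply/eqP; rewrite eqEcard sABC cardsU.
  have -> : A :&: B = set0 by apply/setP => y; rewrite inE dAB inE.
  rewrite cards0 subn0 card_imset; last exact: inv_inj.
  have := cardsC [set u; v]; rewrite -/C cards2 uv card_H.
  have := min_deg u; have := min_deg v; rewrite /degree; rewrite -/B; lia.
have xA : (x \in A) = adj u (f x).
  by rewrite -{1}(fK x) mem_imset ?inE //; apply: inv_inj.
have := dAB x; have : x \in A :|: B by rewrite eqABC !inE negb_or xu xv.
by rewrite inE xA inE; case: (adj u _) => //= ->.
Qed.

(** The image under [f] of the neighbours of [u] is disjoint from those of [v], and both lie among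
    the [2m - 2] other vertices; so the two degrees, each at least [m - 1], sum to at most
    [2m - 2]. *)
Lemma unmatched_degree f u v :
  maximum_matching f -> u != v -> f u = u -> f v = v -> degree u = m - 1.
Proof.
move=> maxf uv fu fv; have fK := matchingK maxf.1.
have nuv := unmatched_nadj maxf fu fv.
have sN : f @: nbhd u \subset ~: [set u; v] :\: nbhd v.
  apply/subsetP => y /imsetP[x]; rewrite !inE => ux ->.
  have xu : x != u by apply: contraTneq ux => ->; rewrite adj_irrefl.
  have xv : x != v by apply: contraTneq ux => ->; rewrite nuv.
  rewrite negb_or !(inv_eq fK) fu fv xu xv andbT.
  by rewrite (unmatched_pair maxf uv fu fv) ?fK ?ux // (inv_eq fK) ?fu ?fv.
have := subset_leq_card sN; rewrite card_imset; last exact: inv_inj.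
have sNv : nbhd v \subset ~: [set u; v].
  apply/subsetP => x; rewrite !inE => vx; rewrite negb_or.
  by apply/andP; split; apply: contraTneq vx => ->; rewrite ?adj_irrefl // adj_sym nuv.
rewrite cardsD (setIidPr sNv).
have := cardsC [set u; v]; rewrite cards2 uv card_H.
have := min_deg u; have := min_deg v; rewrite /degree; lia.
Qed.

Hypothesis indep : forall A : {set H}, independent A -> #|A| <= m.

(* Otherwise [u] and [v] have the same neighbours, and every other edge of [f]
   joins this common neighbourhood to its complement, which is then an
   independent set of size [m + 1]. *)
Lemma unmatched_triangle f u v :
  maximum_matching f -> u != v -> f u = u -> f v = v ->
  exists x, adj u x && adj u (f x).
Proof.
move=> maxf uv fu fv; have fK := matchingK maxf.1.
have [/existsP // | nex] := boolP [exists x, adj u x && adj u (f x)].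
have nuf x : adj u x -> adj u (f x) = false.
  by move=> ux; apply: contraNF nex => ufx; apply/existsP; exists x; rewrite ux.
have star := unmatched_pair maxf uv fu fv.
have nuv := unmatched_nadj maxf fu fv.
have degu := unmatched_degree maxf uv fu fv.
have degv : degree v = m - 1 by apply: unmatched_degree maxf _ fv fu; rewrite eq_sym.
have eqN : nbhd u = nbhd v.
  apply/eqP; rewrite eqEcard -/(degree u) -/(degree v) degu degv leqnn andbT.
  apply/subsetP => x; rewrite !inE => ux; rewrite star ?nuf //.
    by apply: contraTneq ux => ->; rewrite adj_irrefl.
  by apply: contraTneq ux => ->; rewrite nuv.
have adjv x : adj v x = adj u x by have /setP/(_ x) := eqN; rewrite !inE.
have : independent (~: nbhd u).
  apply/forallP => y; apply/implyP; rewrite !inE => uy.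
  apply/forallP => z; apply/implyP; rewrite !inE => uz.
  apply/negP => yz.
  have yu : y != u by apply: contraNneq uz => <-.
  have yv : y != v by apply: contraNneq uz => yv; rewrite -adjv -yv.
  have zu : z != u by apply: contraNneq uy => <-; rewrite adj_sym.
  have zv : z != v by apply: contraNneq uy => zv; rewrite -adjv -zv adj_sym.
  have uf x : x != u -> x != v -> ~~ adj u x -> adj u (f x).
    by move=> xu xv; rewrite -adjv star // negbK.
  have ufy := uf _ yu yv uy; have ufz := uf _ zu zv uz.
  have zy : z != y by apply: contraTneq yz => ->; rewrite adj_irrefl.
  (* Inserting the edge between [u] and [f y] frees [y]; as [v] is adjacent to [f z],
     [unmatched_pair] for [y] and [v] excludes the edge [y z]. *)
  have gy : rematch f u (f y) y = y by have := rematch_free maxf fu ufy; rewrite fK.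
  have gv : rematch f u (f y) v = v.
    by rewrite rematch_id ?fK // 1?eq_sym // (inv_eq fK) fv.
  have fzy : f z != y by apply: contraTneq ufz => ->.
  have fzv : f z != v by rewrite (inv_eq fK) fv.
  have := unmatched_pair (maximum_rematch maxf fu ufy) yv gy gv fzy fzv.
  rewrite adjv ufz rematch_id ?fK ?yz // ?(inj_eq (inv_inj fK)) //.
  by rewrite (inv_eq fK) fu.
move=> /indep; rewrite cardsCs setCK -/(degree u) degu card_H.
(* Subtraction is truncated: the complement has [m + 1] elements only because [m] is positive. *)
have : 0 < #|H| by apply/card_gt0P; exists u.
rewrite card_H; lia.
Qed.

(** Let [z (f z)] be a matching edge forming a triangle with [u], and [x] a common neighbour.
    Inserting [u x] frees [f x], and since [v] misses [z] this forces an edge between [f x] and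
    [f z]; inserting [u z] frees [f z], and since [v] meets [x] this forbids the same edge. *)
Lemma unmatched_common_nbhd f u v x :
  maximum_matching f -> u != v -> f u = u -> f v = v ->
  adj u x -> adj v x = false.
Proof.
move=> maxf uv fu fv ux; have fK := matchingK maxf.1; apply/negP => vx.
have [z /andP[uz ufz]] := unmatched_triangle maxf uv fu fv.
have star := unmatched_pair maxf uv fu fv.
have nuv := unmatched_nadj maxf fu fv.
have nbh t : adj u t -> (t != u) && (t != v).
  by move=> ut; apply/andP; split; apply: contraTneq ut => ->; rewrite ?adj_irrefl ?nuv.
have [xu xv] := andP (nbh _ ux); have [zu zv] := andP (nbh _ uz).
have [fzu fzv] := andP (nbh _ ufz).
have vz : adj v z = false by rewrite star // ufz.
have vfz : adj v (f z) = false by rewrite star // fK uz.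
have zx : z != x by apply: contraTneq vx => <-; rewrite vz.
have fzx : f z != x by apply: contraTneq vx => <-; rewrite vfz.
have ufx : adj u (f x) = false by apply: negbTE; rewrite -star.
have xfz : x != f z by rewrite eq_sym.
have fxv : f x != v by rewrite (inv_eq fK) fv.
have fxz : f x != z by rewrite (inv_eq fK).
have vg a : adj u a -> f a != v -> rematch f u a v = v.
  move=> ua fav; have [_ av] := andP (nbh _ ua).
  by rewrite rematch_id // eq_sym.
have := unmatched_pair (maximum_rematch maxf fu ux) fxv
          (rematch_free maxf fu ux) (vg _ ux fxv) _ zv.
rewrite vz rematch_id // 1?eq_sym // => /(_ fxz) /esym/negbFE adj1.
have := unmatched_pair (maximum_rematch maxf fu uz) fzv
          (rematch_free maxf fu uz) (vg _ uz fzv) xfz xv.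
by rewrite vx rematch_id // 1?eq_sym // adj_sym adj1.
Qed.

(** The cliques are the closed neighbourhood [U] of [u] and its complement: no edge joins them, and
    the degree bound fills each. As [f] pairs off the [m - 1] neighbours of [u], [m] is odd. *)
Lemma two_cliques f u v :
  maximum_matching f -> u != v -> f u = u -> f v = v ->
  exists U : {set H},
    [/\ odd m, #|U| = m &
        forall x y, adj x y = (x != y) && ((x \in U) == (y \in U))].
Proof.
move=> maxf uv fu fv; have fK := matchingK maxf.1.
have star := unmatched_pair maxf uv fu fv.
have nuv := unmatched_nadj maxf fu fv.
have common := unmatched_common_nbhd maxf uv fu fv.
have nbu t : adj u t -> t != u by apply: contraTneq => ->; rewrite adj_irrefl.
have nbv t : adj u t -> t != v by apply: contraTneq => ->; rewrite nuv.
have m_gt0 : 0 < m by have : 0 < #|H| by [apply/card_gt0P; exists u]; rewrite card_H; lia.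
pose U := u |: nbhd u.
have degu := unmatched_degree maxf uv fu fv.
have cardU : #|U| = m by rewrite cardsU1 inE adj_irrefl -/(degree u) degu; lia.
have cardCU : #|~: U| = m by have := cardsC U; rewrite cardU card_H; lia.
have fN x : adj u x -> adj u (f x).
  move=> ux; have := star _ (nbu _ ux) (nbv _ ux).
  by rewrite (common _ ux) => /esym/negbFE.
have cross x y : x \in U -> y \notin U -> adj x y = false.
  rewrite !inE negb_or => xU /andP[yu uy].
  have [->|xu] := eqVneq x u; first exact: negbTE.
  rewrite (negPf xu) /= in xU.
  have [->|yv] := eqVneq y v; first by rewrite adj_sym common.
  (* Inserting the edge between [u] and [f x] frees [x]; as [v] is adjacent to [f y],
     [unmatched_pair] for [x] and [v] excludes the edge [x y]. *)
  have ufx := fN _ xU.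
  have gx : rematch f u (f x) x = x by have := rematch_free maxf fu ufx; rewrite fK.
  have gv : rematch f u (f x) v = v.
    by rewrite rematch_id ?fK // eq_sym ?uv //; apply: nbv.
  have fyx : f y != x by apply: contraNneq uy => fyx; rewrite -(fK y) fyx.
  have fyv : f y != v by rewrite (inv_eq fK) fv.
  have fyu : f y != u by rewrite (inv_eq fK) fu.
  have vfy : adj v (f y) by rewrite star // fK.
  have := unmatched_pair (maximum_rematch maxf fu ufx) (nbv _ xU) gx gv fyx fyv.
  rewrite vfy rematch_id ?fK //; first by move/esym/negbTE.
  by rewrite (inj_eq (inv_inj fK)); apply: contraNneq uy => ->.
have clique (W : {set H}) x y : #|W| = m ->
    (forall a b, a \in W -> b \notin W -> adj a b = false) ->
    x \in W -> y \in W -> x != y -> adj x y.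
  move=> cardW crossW xW yW xy.
  suff /setP/(_ y) : nbhd x = W :\ x by rewrite !inE yW eq_sym xy.
  apply/eqP; rewrite eqEcard; apply/andP; split; last first.
    by have := min_deg x; have := cardsD1 x W; rewrite xW cardW /degree; lia.
  apply/subsetP => z; rewrite !inE => xz; apply/andP; split.
    by apply: contraTneq xz => ->; rewrite adj_irrefl.
  by apply: contraTT xz => zW; rewrite crossW.
exists U; split=> //.
  have : ~~ odd #|nbhd u|.
    apply: (card_involution_even fK) => x; rewrite !inE; first exact: fN.
    exact: maximum_matching_nbhd.
  by rewrite -/(degree u) degu -{2}(subnK m_gt0) oddD => /negPf->.
move=> x y; have [->|xy] /= := eqVneq x y; first by rewrite adj_irrefl.
have [xU | xU] := boolP (x \in U); have [yU | yU] := boolP (y \in U).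
- by rewrite (clique U).
- by rewrite cross.
- by rewrite adj_sym cross.
rewrite (clique (~: U)) ?in_setC // => a b; rewrite !in_setC negbK => aU bU.
by rewrite adj_sym cross.
Qed.

Lemma perfect_or_two_cliques :
  (exists f, matching f /\ unmatched f = set0) \/
  exists U : {set H},
    [/\ odd m, #|U| = m &
        forall x y, adj x y = (x != y) && ((x \in U) == (y \in U))].
Proof.
have [f maxf] := ex_maximum_matching; have fK := matchingK maxf.1.
have [f0 | [u]] := set_0Vmem (unmatched f); first by left; exists f; case: maxf.
rewrite inE => /eqP fu; right.
(* A single unmatched vertex is impossible: the matched ones are even in number, and so is
   [#|H|]. *)
have [fD | [v]] := set_0Vmem (unmatched f :\ u).
  have : ~~ odd #|~: unmatched f|.
    apply: (card_involution_even fK) => x; rewrite !inE //.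
    by rewrite (inj_eq (inv_inj fK)).
  have := cardsC (unmatched f); rewrite (cardsD1 u) fD cards0 inE fu eqxx card_H.
  by lia.
by rewrite !inE => /andP[vu /eqP fv]; apply: (two_cliques maxf (u := u) (v := v));
  rewrite // eq_sym.
Qed.

(** * Perfect matchings as sets of edges *)

Lemma matching_perfect f :
  matching f -> unmatched f = set0 -> exists M : {set {set H}}, perfect_matching M.
Proof.
move=> mf f0; have fK := matchingK mf.
have nfix x : f x != x by have /setP/(_ x) := f0; rewrite !inE => /negbT.
exists [set [set x; f x] | x : H]; apply/and3P; split.
- apply/subsetP => e /imsetP[x _ ->]; apply/imsetP; exists (x, f x) => //.
  by rewrite inE /= matching_adj.
- apply/trivIsetP => A B /imsetP[x _ ->] /imsetP[y _ ->]; apply: contraNT.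
  case/pred0Pn => z /=; rewrite !inE => /andP[/pred2P zx /pred2P zy].
  have pairE t : z = t \/ z = f t -> [set t; f t] = [set z; f z].
    by case=> ->; rewrite ?fK // setUC.
  by rewrite (pairE x) // (pairE y).
apply/eqP/setP => x; rewrite !inE; apply/bigcupP; exists [set x; f x].
  exact: imset_f.
by rewrite !inE eqxx.
Qed.

(** The [m] blocks of [M] are edges, so each contains at most one vertex of [A]. *)
Lemma perfect_matching_independent (M : {set {set H}}) (A : {set H}) :
  perfect_matching M -> independent A -> #|A| <= m.
Proof.
move=> /and3P[/subsetP ME tM cM] indA.
have partM : partition M [set: H].
  rewrite /partition cM tM; apply/negP => /ME /imsetP[p _] /setP/(_ p.1).
  by rewrite !inE eqxx.
have edgeP e : e \in M -> exists x y, adj x y /\ e = [set x; y].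
  by move=> /ME /imsetP[p]; rewrite inE => pA ->; exists p.1, p.2.
have card2 : {in M, forall e : {set H}, #|e| = 2}.
  move=> e /edgeP[x [y [xy ->]]]; rewrite cards2.
  by case: eqVneq xy => // ->; rewrite adj_irrefl.
have := card_uniform_partition card2 partM; rewrite cardsT card_H => cardM.
have -> : m = #|M| by lia.
have cov x : x \in cover M by rewrite (eqP cM) inE.
have injA : {in A &, injective (pblock M)}.
  move=> x y xA yA eqb.
  have xB : x \in pblock M x by rewrite mem_pblock.
  have yB : y \in pblock M x by rewrite eqb mem_pblock.
  have [a [b [ab eB]]] := edgeP _ (pblock_mem (cov x)).
  have nA s t : s \in A -> t \in A -> adj s t = false.
    move=> sA tA; apply: negbTE.
    by have /forallP/(_ s)/implyP/(_ sA)/forallP/(_ t)/implyP/(_ tA) := indA.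
  move: xB yB; rewrite eB !inE => /pred2P[] ex /pred2P[] ey; subst => //.
    by rewrite nA in ab.
  by rewrite nA in ab.
rewrite -(card_in_imset injA); apply: subset_leq_card.
by apply/subsetP => e /imsetP[x _ ->]; apply: pblock_mem.
Qed.

End InvolutiveMatchings.

(** * Transfer between a graph and its vertex-deleted subgraph *)

Section DeleteVertices.
Variables (G : sgraph) (S : {set G}).

Definition delete_val (x : delete S) : G := sval x.

Lemma delete_val_inj : injective delete_val.
Proof. exact: val_inj. Qed.

Lemma delete_valP (x : delete S) : delete_val x \notin S.
Proof. exact: (valP (x : {y : G | y \notin S})). Qed.

Lemma delete_valE (y : G) : y \notin S -> exists x, delete_val x = y.
Proof. by move=> yS; exists (exist _ y yS). Qed.

Lemma adj_delete (x y : delete S) : adj (delete_val x) (delete_val y) = adj x y.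
Proof. by []. Qed.

Lemma card_delete : #|delete S| = #|G| - #|S|.
Proof.
rewrite card_sig -(cardsC S) addKn.
by apply: eq_card => x; rewrite !inE.
Qed.

Lemma degree_delete (x : delete S) :
  degree (delete_val x) = #|[set y in S | adj (delete_val x) y]| + degree x.
Proof.
rewrite /degree -(card_imset _ delete_val_inj) -(cardsID S [set y | adj _ y]).
congr (_ + _); apply: eq_card => y; rewrite !inE; first exact: andbC.
apply/andP/imsetP => [[/delete_valE[z <-] xz] | [z]]; first by exists z; rewrite ?inE.
by rewrite inE => xz ->; rewrite delete_valP.
Qed.

Lemma independent_delete (A : {set delete S}) :
  independent A -> independent (delete_val @: A).
Proof.
move=> indA; apply/forall_inP => _ /imsetP[x xA ->].
apply/forall_inP => _ /imsetP[y yA ->].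
by have /forall_inP/(_ x xA)/forall_inP/(_ y yA) := indA.
Qed.

Lemma independent_preim (A : {set G}) :
  independent A -> independent (delete_val @^-1: A).
Proof.
move=> indA; apply/forall_inP => x; rewrite inE => xA.
apply/forall_inP => y; rewrite inE => yA.
by have /forall_inP/(_ _ xA)/forall_inP/(_ _ yA) := indA.
Qed.

End DeleteVertices.

(** * Choice of subsets, and recognition of the exceptional join *)

Lemma ex_enum_ord (T : finType) (A : {set T}) (m : nat) :
  #|A| = m -> exists2 e : 'I_m -> T, injective e & forall i, e i \in A.
Proof. by move=> <-; exists enum_val; [exact: enum_val_inj | exact: enum_valP]. Qed.

Lemma ex_subset_card (T : finType) (B : {set T}) (k : nat) :
  k <= #|B| -> exists2 A : {set T}, A \subset B & #|A| = k.
Proof.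
rewrite -bin_gt0 -cards_draws => /card_gt0P[A].
by rewrite inE => /andP[AB /eqP Ak]; exists A.
Qed.

(** Here [delete (~: S)] is the subgraph induced by [S]. Enumerations of [U] and of its complement
    give a bijection [h] from the join to [G], whose inverse is the isomorphism. *)
Lemma isomorphic_join_cliques (G : sgraph) (S : {set G}) (m : nat)
    (U : {set delete S}) :
  #|G| = #|S| + m.*2 -> #|U| = m ->
  (forall x y : delete S, adj x y = (x != y) && ((x \in U) == (y \in U))) ->
  (forall x y : G, x \notin S -> y \in S -> adj x y) ->
  isomorphic G (graph_join (delete (~: S))
                  (graph_union (complete_graph m) (complete_graph m))).
Proof.
move=> cardG cardU adjU adjS.
have cardCU : #|~: U| = m by have := cardsC U; rewrite cardU card_delete; lia.
have [e1 inj1 e1U] := ex_enum_ord cardU; have [e2 inj2 e2U] := ex_enum_ord cardCU.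
have {}e2U i : e2 i \in U = false by apply: negbTE; have := e2U i; rewrite inE.
pose J := graph_join (delete (~: S)) (graph_union (complete_graph m) (complete_graph m)).
pose h (t : J) : G :=
  match t with
  | inl a => delete_val a
  | inr (inl i) => delete_val (e1 i)
  | inr (inr i) => delete_val (e2 i)
  end.
have aS (a : delete (~: S)) : delete_val a \in S.
  by have := delete_valP a; rewrite inE negbK.
have hadj s t : adj (h s) (h t) = adj s t.
  case: s t => [a|[i|i]] [b|[j|j]] //=.
  - by rewrite adj_sym adjS ?delete_valP.
  - by rewrite adj_sym adjS ?delete_valP.
  - by rewrite adjS ?delete_valP.
  - by rewrite adj_delete adjU !e1U eqxx andbT (inj_eq inj1).
  - by rewrite adj_delete adjU e1U e2U andbF.
  - by rewrite adjS ?delete_valP.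
  - by rewrite adj_delete adjU e1U e2U andbF.
  - by rewrite adj_delete adjU !e2U eqxx andbT (inj_eq inj2).
have SC (a : delete (~: S)) (x : delete S) : delete_val a != delete_val x.
  by apply: contraTneq (aS a) => ->; exact: delete_valP.
have e12 i j : e1 i != e2 j by apply: contraTneq (e1U i) => ->; rewrite e2U.
have injh : injective h.
  move=> [a|[i|i]] [b|[j|j]] /= /eqP eh.
  - by rewrite (inj_eq (@delete_val_inj _ _)) in eh; rewrite (eqP eh).
  - by rewrite (negPf (SC _ _)) in eh.
  - by rewrite (negPf (SC _ _)) in eh.
  - by rewrite eq_sym (negPf (SC _ _)) in eh.
  - by rewrite (inj_eq (@delete_val_inj _ _)) (inj_eq inj1) in eh; rewrite (eqP eh).
  - by rewrite (inj_eq (@delete_val_inj _ _)) (negPf (e12 _ _)) in eh.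
  - by rewrite eq_sym (negPf (SC _ _)) in eh.
  - by rewrite (inj_eq (@delete_val_inj _ _)) eq_sym (negPf (e12 _ _)) in eh.
  - by rewrite (inj_eq (@delete_val_inj _ _)) (inj_eq inj2) in eh; rewrite (eqP eh).
have bijh : bijective h.
  apply: inj_card_bij injh _.
  by rewrite !card_sum !card_ord card_delete -cardsCs cardG addnn leqnn.
have [g gK hK] := bijh; exists g; first by exists h.
by move=> x y; rewrite -hadj !hK.
Qed.

(** * The characterisation of factor-critical graphs *)

Theorem theorem10 (G : sgraph) (n : nat)
    (G_connected : connected G)
    (n_pos : 0 < n)
    (n_lt : n < #|G|)
    (parity : #|G| = n %[mod 2])
    (min_deg : (#|G| + n)./2 - 1 <= min_degree G)
    (not_exceptional :
       ~ exists G0 : sgraph,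
           [/\ odd ((#|G| - n)./2),
               #|G0| = n &
               isomorphic G
                 (graph_join G0
                    (graph_union (complete_graph ((#|G| - n)./2))
                                 (complete_graph ((#|G| - n)./2))))]) :
  factor_critical n G <-> independence_number G <= (#|G| - n)./2.
Proof.
set m := (#|G| - n)./2 in not_exceptional *.
(* By parity the halving is exact. *)
have cardG : #|G| = n + m.*2 by rewrite /m; lia.
have degG (x : G) : n + m - 1 <= degree x.
  by apply: leq_trans (leq_trans min_deg (bigmin_leq _ _ x)); rewrite cardG; lia.
have cardH (S : {set G}) : #|S| = n -> #|delete S| = m.*2.
  by move=> cardS; rewrite card_delete; lia.
split=> [fcG | alphaG S cardS].
  apply/bigmax_leqP => I indI; rewrite leqNgt; apply/negP => ltmI.
  (* Exactly [m + 1] vertices are kept: the [n + m - 1] others then suffice for [S], since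
     [n < #|G|] gives [0 < m]. *)
  have [J sJI cardJ] := ex_subset_card ltmI.
  have [S sS cardS] : exists2 S : {set G}, S \subset ~: J & #|S| = n.
    by apply: ex_subset_card; have := cardsC J; rewrite cardG cardJ; lia.
  have [M perfM] := fcG S cardS.
  have indJ : independent J.
    apply/forall_inP => x xJ; apply/forall_inP => y yJ.
    by have /forall_inP/(_ x (subsetP sJI _ xJ))/forall_inP/(_ y (subsetP sJI _ yJ)) := indI.
  have := perfect_matching_independent (cardH _ cardS) perfM (independent_preim S indJ).
  rewrite -(card_imset _ (@delete_val_inj _ S)) => le_m.
  suff: m < m by rewrite ltnn.
  apply: leq_trans le_m; rewrite -cardJ; apply: subset_leq_card; apply/subsetP => x xJ.
  have [|y yx] := @delete_valE _ S x.
    by apply: contraTN xJ => /(subsetP sS); rewrite inE.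
  by rewrite -yx imset_f // inE yx.
have degH (x : delete S) : m - 1 <= degree x.
  have := degG (delete_val x); rewrite degree_delete.
  have : #|[set y in S | adj (delete_val x) y]| <= #|S|.
    by apply: subset_leq_card; apply/subsetP => y; rewrite inE => /andP[].
  by lia.
have indH (A : {set delete S}) : independent A -> #|A| <= m.
  move=> /independent_delete indA; rewrite -(card_imset _ (@delete_val_inj _ S)).
  apply: leq_trans alphaG.
  exact: (leq_bigmax_cond (P := @independent G) (F := fun B : {set G} => #|B|)).
have [[f [mf f0]] | [U [odd_m cardU adjU]]] :=
  perfect_or_two_cliques (cardH _ cardS) degH indH.
  exact: matching_perfect mf f0.
case: not_exceptional; exists (delete (~: S)); split=> //.
  by rewrite card_delete -cardsCs.
apply: (isomorphic_join_cliques _ cardU adjU); first by rewrite cardS.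
move=> x y /delete_valE[{}x <-] yS.
(* In [G - S] the neighbours of [x] are the rest of its clique [W], so the bound [n + m - 1] in [G]
   makes [x] adjacent to all [n] vertices of [S]. *)
have degx : degree x = m - 1.
  pose W := [set z | (x \in U) == (z \in U)].
  have cardW : #|W| = m.
    have := cardsC U; rewrite cardU (cardH _ cardS) -addnn => /addnI cardCU.
    rewrite /W; case: (x \in U); [rewrite -[RHS]cardU | rewrite -[RHS]cardCU];
      by apply: eq_card => z; rewrite !inE; case: (z \in U).
  have -> : degree x = #|W :\ x| by apply: eq_card => z; rewrite !inE adjU eq_sym.
  by rewrite -cardW (cardsD1 x W) inE eqxx addKn.
have := degG (delete_val x); rewrite degree_delete degx => le_n.
suff /setP/(_ y) : [set z in S | adj (delete_val x) z] = S by rewrite !inE yS.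
apply/eqP; rewrite eqEcard; apply/andP; split; last by move: le_n; rewrite cardS; lia.
by apply/subsetP => z; rewrite inE => /andP[].
Qed.
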